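(* Let $n$ and $k$ be integers with $3\leq k\leq n-1$. A graph $G$ on $n$ vertices is the $(1,2)$-step competition graph $C_{1,2}(T)$ of some strong $k$-hypertournament $T$ on $n$ vertices if and only if $G$ is $K_{n}$, $K_{n}-E(P_{2})$, or $K_{n}-E(P_{3})$.
   Context: Given integers $n\geq k>1$, a $k$-hypertournament on $n$ vertices is a pair $T=(V,A)$ where $|V|=n$ and $A$ is a set of $k$-tuples of distinct vertices (arcs) such that for every $k$-subset $S$ of $V$, $A$ contains exactly one of the $k!$ $k$-tuples whose entries are the elements of $S$. If $v_i,v_j$ both appear in an arc $a$ and $v_i$ precedes $v_j$ in $a$, we say $v_i$ dominates $v_j$ in $a$. A path in $T$ is a sequence $v_1a_1v_2a_2\cdots a_{t-1}v_t$ of distinct vertices $v_1,\dots,v_t$ ($t\geq1$) and distinct arcs $a_1,\dots,a_{t-1}$ such that $v_i$ precedes $v_{i+1}$ in $a_i$; its length is the number $t-1$ of arcs, and it is an $(x,y)$-path if $v_1=x$, $v_t=y$. $T$ is strong if it has an $(x,y)$-path for every ordered pair of distinct vertices $x,y$. For integers $i,j\geq1$, the $(i,j)$-step competition graph $C_{i,j}(T)$ is the graph on $V(T)$ in which $xy$ is an edge if and only if there exist a vertex $z\neq x,y$, an $(x,z)$-path $P$ and a $(y,z)$-path $Q$ such that: $y\notin V(P)$ and $x\notin V(Q)$; either ($l(P)\leq i$ and $l(Q)\leq j$) or ($l(Q)\leq i$ and $l(P)\leq j$); and $P$, $Q$ have no arc in common. $P_m$ denotes the path on $m$ vertices, so $K_n-E(P_2)$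 is $K_n$ with one edge removed and $K_n-E(P_3)$ is $K_n$ with two edges sharing a vertex removed. *)

(* Defs.v *)
From mathcomp Require Import all_boot.
Set Implicit Arguments.
Unset Strict Implicit.
Unset Printing Implicit Defensive.

Record sgraph (V : finType) := SGraph {
  adj : V -> V -> Prop;
  adj_sym : forall x y, adj x y -> adj y x;
  adj_irrefl : forall x, ~ adj x x }.

Definition sgraph_iso (V W : finType) (G : sgraph V) (H : sgraph W) : Prop :=
  exists f : V -> W, bijective f /\ forall x y, adj G x y <-> adj H (f x) (f y).

Section CompleteMinusPath.
Variables n m : nat.

Definition complete_adj (u v : 'I_n) : Prop := u <> v.

Lemma complete_adj_sym u v : complete_adj u v -> complete_adj v u.
Proof. by move=> neq_uv eq_vu; apply: neq_uv. Qed.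

Lemma complete_adj_irrefl u : ~ complete_adj u u.
Proof. by apply. Qed.

Definition complete_graph : sgraph 'I_n :=
  SGraph complete_adj_sym complete_adj_irrefl.

(* E(P_m) for the copy 0 - 1 - ... - (m-1) of P_m inside 'I_n; this has all m
   vertices only when m <= n. *)
Definition path_edge (u v : 'I_n) : Prop :=
  [/\ u < m, v < m & u.+1 = v :> nat \/ v.+1 = u :> nat].

Definition complete_minus_path_adj (u v : 'I_n) : Prop :=
  u <> v /\ ~ path_edge u v.

Lemma complete_minus_path_adj_sym u v :
  complete_minus_path_adj u v -> complete_minus_path_adj v u.
Proof.
move=> [neq_uv not_edge]; split; first by move=> eq_vu; apply: neq_uv.
by move=> [lt_v lt_u uv]; apply: not_edge; split=> //; case: uv; auto.
Qed.

Lemma complete_minus_path_adj_irrefl u : ~ complete_minus_path_adj u u.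
Proof. by case. Qed.

Definition complete_minus_path : sgraph 'I_n :=
  SGraph complete_minus_path_adj_sym complete_minus_path_adj_irrefl.

End CompleteMinusPath.

Record hypertournament (V : finType) (k : nat) := Hypertournament {
  arcs : {set k.-tuple V};
  arcs_uniq : forall a, a \in arcs -> uniq a;
  arcs_choice : forall S : {set V}, #|S| = k ->
    exists! a : k.-tuple V, a \in arcs /\ [set v in a] = S }.

Section Hypertournament.
Variables (V : finType) (k : nat) (T : hypertournament V k).

Definition dominates (a : k.-tuple V) (x y : V) : bool :=
  [&& x \in a, y \in a & index x a < index y a].

(* The alternating sequence x a_1 v_2 a_2 ... a_(t-1) v_t is encoded by its
   first vertex x and p = [:: (a_1, v_2); ...; (a_(t-1), v_t)], so that its
   length is size p. *)
Fixpoint is_walk (x : V) (p : seq (k.-tuple V * V)) : bool :=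
  if p is (a, v) :: p' then
    [&& a \in arcs T, dominates a x v & is_walk v p']
  else true.

Definition path_vertices (x : V) (p : seq (k.-tuple V * V)) : seq V :=
  x :: unzip2 p.

Definition path_arcs (p : seq (k.-tuple V * V)) : seq (k.-tuple V) := unzip1 p.

Definition is_path (x y : V) (p : seq (k.-tuple V * V)) : Prop :=
  [/\ is_walk x p, uniq (path_vertices x p), uniq (path_arcs p)
    & last x (unzip2 p) = y].

Definition strong : Prop :=
  forall x y : V, x <> y -> exists p, is_path x y p.

Variables i j : nat.

Definition competition_adj (x y : V) : Prop :=
  exists (z : V) (P Q : seq (k.-tuple V * V)),
    [/\ z <> x /\ z <> y,
        is_path x z P /\ is_path y z Q,
        y \notin path_vertices x P /\ x \notin path_vertices y Q,
        (size P <= i /\ size Q <= j) \/ (size Q <= i /\ size P <= j)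
      & forall a, ~ (a \in path_arcs P /\ a \in path_arcs Q)].

Lemma competition_adj_sym x y : competition_adj x y -> competition_adj y x.
Proof.
move=> [z [P [Q [[zx zy] [pP pQ] [yP xQ] len dis]]]]; exists z, Q, P.
by split=> //; [case: len; auto | move=> a [aQ aP]; apply: (dis a)].
Qed.

Lemma competition_adj_irrefl x : ~ competition_adj x x.
Proof. by move=> [z [P [Q [_ _ [+ _]]]]]; rewrite inE eqxx. Qed.

Definition step_competition_graph : sgraph V :=
  SGraph competition_adj_sym competition_adj_irrefl.

End Hypertournament.

(* Main.v *)
(** Write [out x y] when [x] dominates [y] in some arc; every pair of vertices
    lies in a common arc, so [out x y] or [out y x]. If [x] and [y] are not
    adjacent in C_{1,2}(T), then either one of them dominates only the other, or
    all arrows leaving [{x, y}] lie in a single arc, or n = 4 and every other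
    vertex dominates everything. Indeed, take arrows x -> z in [a] and y -> w in
    [b] with [a <> b]; an arc through [z] and [w] other than [a] and [b] would
    extend one of the two arrows to a path of length 2 ending where the other
    ends, so [a] and [b] are the only such arcs, which forces n = 4. A strong [T]
    has at most two vertices of out-degree 1 (three would form a closed 3-cycle)
    and at most one non-adjacent pair of the last two kinds; there are thus at
    most two non-adjacent pairs, and two of them share a vertex.

    Conversely, order the vertices of each arc one way if the arc contains a
    fixed vertex [v1] and the opposite way if not: any two other vertices then
    dominate each other, and only the arrows at one or two vertices have to be
    adjusted to obtain each of the three graphs. *)

From Stdlib Require Import Classical.
Require Import Defs.
From mathcomp Require Import all_boot zify.

Set Implicit Arguments.
Unset Strict Implicit.
Unset Printing Implicit Defensive.

Lemma subset_of_card (V : finType) (A B : {set V}) (k : nat) :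
  A \subset B -> #|A| <= k <= #|B| ->
  exists S : {set V}, [/\ A \subset S, S \subset B & #|S| = k].
Proof.
move=> sAB /andP[]; elim: k => [|k IHk] leAk lekB.
  by exists A; split=> //; apply/eqP; rewrite -leqn0.
have [eqA | neqA] := eqVneq #|A| k.+1; first by exists A.
have [||S [sAS sSB cS]] := IHk; [lia | lia |].
have /properP[_ [v vB vS]] : S \proper B.
  by rewrite properE sSB /=; apply: contraTN lekB => /subset_leq_card; lia.
exists (v |: S); split; last by rewrite cardsU1 vS cS.
  by rewrite (subset_trans sAS) ?subsetUr.
by rewrite subUset sub1set vB.
Qed.

Lemma prefix_bijection (W : finType) (s : seq W) : uniq s ->
  exists g : W -> 'I_#|W|, bijective g /\ {in s, forall v, g v = index v s :> nat}.
Proof.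
move=> us; pose l := s ++ [seq v <- enum W | v \notin s].
have ul : uniq l.
  rewrite cat_uniq us filter_uniq ?enum_uniq // andbT /=.
  by apply/hasPn=> v; rewrite mem_filter => /andP[].
have ml v : v \in l by rewrite mem_cat mem_filter mem_enum andbT orbN.
have sl : size l = #|W|.
  by rewrite -(card_uniqP ul); apply: eq_card => v; rewrite ml inE.
have lt_il v : index v l < #|W| by rewrite -sl index_mem.
exists (fun v => Ordinal (lt_il v)); split.
  apply: inj_card_bij; last by rewrite card_ord.
  by move=> u v [] /index_inj -> //; rewrite ml.
by move=> v vs; rewrite /= index_cat vs.
Qed.

Section Nonedges.
Variables (V : finType) (k : nat) (T : hypertournament V k).
Implicit Types (a b c : k.-tuple V) (x y z u v w : V).

Definition arrow a x y := (a \in arcs T) && dominates a x y.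
Definition out x y := exists a, arrow a x y.
Definition full x := forall y, y <> x -> out x y.
Definition only_out x y := forall z, out x z -> z = y.

Lemma arrow_arc a x y : arrow a x y -> a \in arcs T.
Proof. by case/andP. Qed.

Lemma arrow_meml a x y : arrow a x y -> x \in a.
Proof. by case/and4P. Qed.

Lemma arrow_memr a x y : arrow a x y -> y \in a.
Proof. by case/and4P. Qed.

Lemma arrow_neq a x y : arrow a x y -> x <> y.
Proof. by case/and4P=> _ _ _ /[swap] ->; rewrite ltnn. Qed.

Lemma out_neq x y : out x y -> x <> y.
Proof. by case=> a /arrow_neq. Qed.

Lemma arrow_total a x y : a \in arcs T -> x \in a -> y \in a -> x <> y ->
  arrow a x y \/ arrow a y x.
Proof.
move=> aT xa ya neq; rewrite /arrow /dominates aT xa ya /=.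
case: (ltngtP (index x a) (index y a)); [by left | by right |].
by move/(index_inj x xa ya).
Qed.

Lemma arrow_trans a : transitive (arrow a).
Proof.
move=> y x z /and4P[aT xa ya lxy] /and4P[_ _ za lyz].
by rewrite /arrow /dominates aT xa za (ltn_trans lxy lyz).
Qed.

Lemma competition_adj1 a b x y z : x <> y -> a <> b ->
  arrow a x z -> arrow b y z -> competition_adj T 1 2 x y.
Proof.
move=> xy ab ax by_; have xz := arrow_neq ax; have yz := arrow_neq by_.
exists z, [:: (a, z)], [:: (b, z)]; split=> //.
- by split; apply/nesym.
- case/andP: ax => aT ax; case/andP: by_ => bT by_.
  by rewrite /is_path /= aT bT ax by_ !inE !andbT; split; split=> //; apply/eqP.
- by rewrite /path_vertices /= !inE; split; apply/norP; split; apply/eqP;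
    auto.
- by left.
- by move=> c; rewrite !inE => -[/eqP-> /eqP].
Qed.

Lemma competition_adj2 a b c x y w z : x <> y -> w <> x -> z <> y ->
  a <> b -> a <> c -> b <> c ->
  arrow a x z -> arrow b y w -> arrow c w z -> competition_adj T 1 2 x y.
Proof.
move=> xy wx zy ab ac bc ax by_ cw.
have xz := arrow_neq ax; have yw := arrow_neq by_; have wz := arrow_neq cw.
exists z, [:: (a, z)], [:: (b, w); (c, z)]; split.
- by split=> //; apply/nesym.
- case/andP: ax => aT ax; case/andP: by_ => bT by_; case/andP: cw => cT cw.
  rewrite /is_path /= aT bT cT ax by_ cw !inE !andbT.
  split; split=> //; first exact/eqP; last exact/eqP.
  by rewrite negb_or; apply/andP; split; [apply/andP; split|]; apply/eqP; auto.
- rewrite /path_vertices /= !inE; split; rewrite !negb_or;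
    by repeat (apply/andP; split); apply/eqP; auto.
- by left.
- by move=> d; rewrite !inE => -[/eqP-> /orP[]/eqP].
Qed.

Lemma competition_adj_leaving i j x y : competition_adj T i j x y ->
  exists a b z w, [/\ arrow a x z, arrow b y w, z <> y, w <> x & a <> b].
Proof.
case=> t [[|[a z] P] [[|[b w] Q]]] [[tx ty] [pP pQ] [yP xQ] _ dis].
- by case: pP => _ _ _ /= /esym.
- by case: pP => _ _ _ /= /esym.
- by case: pQ => _ _ _ /= /esym.
case: pP => /= /and3P[aT az _] _ _ _; case: pQ => /= /and3P[bT bw _] _ _ _.
exists a, b, z, w; split; rewrite /arrow ?aT ?bT //.
- by move=> zy; rewrite /path_vertices /= zy !inE eqxx orbT in yP.
- by move=> wx; rewrite /path_vertices /= wx !inE eqxx orbT in xQ.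
- by move=> ab; apply: (dis a); rewrite ab !inE !eqxx.
Qed.

Lemma only_out_nonadj i j x y : only_out x y -> ~ competition_adj T i j x y.
Proof.
move=> xy /competition_adj_leaving[a [b [z [w [az _ zy _ _]]]]].
by apply: zy; apply: xy; exists a.
Qed.

Hypotheses (k3 : 2 < k) (kV : k < #|V|).

Lemma arc_through (s : seq V) t : size s <= 3 -> t \notin s ->
  exists a, [/\ a \in arcs T, {subset s <= a} & t \notin a].
Proof.
move=> s3 ts.
have [||S [sS St cS]] := @subset_of_card V [set v in s] (~: [set t]) k.
- by apply/subsetP=> v; rewrite !inE; apply: contraTneq => ->.
- rewrite cardsC1; apply/andP; split; last by lia.
  apply: leq_trans k3; apply: leq_trans s3; rewrite cardsE.
  exact: card_size.
have [a [[aT aS] _]] := arcs_choice T cS; exists a; split=> //.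
  by move=> v vs; have := subsetP sS v; rewrite -aS !inE; apply.
by apply/negP=> ta; have := subsetP St t; rewrite -aS !inE eqxx => /(_ ta).
Qed.

Lemma vertex_outside (s : seq V) : size s <= 3 -> exists t, t \notin s.
Proof.
move=> s3; apply/existsP; rewrite -negb_forall; apply/negP=> /forallP sV.
have /subset_leq_card : [set: V] \subset s by apply/subsetP=> v _; apply: sV.
by rewrite cardsT => /leq_trans/(_ (card_size s)); lia.
Qed.

Lemma arc_vertex_outside a : exists t, t \notin a.
Proof.
apply/existsP; rewrite -negb_forall; apply/negP=> /forallP aV.
have /subset_leq_card : [set: V] \subset a by apply/subsetP=> v _; apply: aV.
by rewrite cardsT => /leq_trans/(_ (card_size a)); rewrite size_tuple; lia.
Qed.

Lemma full_not_only_out x y : full x -> ~ only_out x y.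
Proof.
move=> fx oxy; have [//|t] := @vertex_outside [:: x; y].
rewrite !inE negb_or => /andP[/eqP tx /eqP ty].
by apply: ty; apply: oxy; apply: fx.
Qed.

Lemma out_total x y : x <> y -> out x y \/ out y x.
Proof.
move=> xy; have [//|t tn] := @vertex_outside [:: x; y].
have [//|a [aT sa _]] := @arc_through [:: x; y] t _ tn.
have xa : x \in a by apply: sa; rewrite !inE eqxx.
have ya : y \in a by apply: sa; rewrite !inE eqxx orbT.
by case: (arrow_total aT xa ya xy); [left | right]; exists a.
Qed.

Hypothesis stT : strong T.

Lemma strong_closed (C : V -> Prop) x y :
  (forall u v, C u -> out u v -> C v) -> C x -> C y.
Proof.
move=> clC Cx; case: (classic (x = y)) => [<- // | /stT[p []]].
move=> wp _ _ <-; elim: p x Cx wp => //= -[a v] p IHp x Cx /and3P[aT av wp].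
by apply: IHp wp; apply: clC Cx _; exists a; apply/andP.
Qed.

Lemma strong_out x : exists y, out x y.
Proof.
apply: NNPP => nx; have [//|t] := @vertex_outside [:: x]; rewrite inE => /eqP.
apply; apply: (@strong_closed (eq^~ x) x) => // u v -> uv.
by case: nx; exists v.
Qed.

Lemma only_out_out x y : only_out x y -> out x y.
Proof. by move=> xy; have [z xz] := strong_out x; rewrite -(xy _ xz). Qed.

Definition one_arc_leaving x y := exists a, [/\ x \in a, y \in a,
  forall b z, z <> y -> arrow b x z -> b = a &
  forall b z, z <> x -> arrow b y z -> b = a].

(* This case only arises for n = 4 and k = 3. *)
Definition others_full x y := [/\ exists2 t, t <> x & ~ out x t,
  exists2 t, t <> y & ~ out y t & forall u, u <> x -> u <> y -> full u].

Definition exceptional x y := one_arc_leaving x y \/ others_full x y.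

Lemma one_arc_leaving_sym x y : one_arc_leaving x y -> one_arc_leaving y x.
Proof. by case=> a [xa ya ax ay]; exists a. Qed.

Lemma others_full_sym x y : others_full x y -> others_full y x.
Proof. by case=> nx ny xy; split=> // u uy ux; apply: xy. Qed.

Lemma two_arcs_others_full a b x y z w : x <> y ->
  ~ competition_adj T 1 2 x y ->
  arrow a x z -> z <> y -> arrow b y w -> w <> x -> a <> b ->
  others_full x y.
Proof.
move=> xy nadj ax zy bw wx ab.
have yx := nesym xy; have ba := nesym ab.
have nadj' : ~ competition_adj T 1 2 y x.
  by move=> /competition_adj_sym.
have zw : z <> w.
  by move=> zw; subst w; apply: nadj; apply: (competition_adj1 xy ab ax bw).
have wz := nesym zw; have xz := arrow_neq ax; have yw := arrow_neq bw.
have only_ab c : c \in arcs T -> z \in c -> w \in c -> c = a \/ c = b.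
  move=> cT zc wc; apply: NNPP => /not_or_and[ca cb].
  case: (arrow_total cT zc wc zw) => cc.
    by apply: nadj'; apply: (competition_adj2 yx zy wx ba (nesym cb) (nesym ca) bw ax cc).
  by apply: nadj; apply: (competition_adj2 xy wx zy ab (nesym ca) (nesym cb) ax bw cc).
have inab p q : q \notin [:: z; w; p] ->
    exists c, [/\ c = a \/ c = b, z \in c, w \in c, p \in c & q \notin c].
  move=> qn; have [//|c [cT sc qc]] := @arc_through [:: z; w; p] q _ qn.
  have zc : z \in c by apply: sc; rewrite !inE eqxx.
  have wc : w \in c by apply: sc; rewrite !inE eqxx orbT.
  have pc : p \in c by apply: sc; rewrite !inE eqxx !orbT.
  by exists c; split=> //; apply: only_ab.
have all4 t : t \in [:: x; y; z; w].
  apply: contraT; rewrite !inE !negb_or => /and4P[/eqP tx /eqP ty /eqP tz /eqP tw].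
  have [|c1 [c1ab _ _ xc1 yc1]] := inab x y.
    by rewrite !inE !negb_or; apply/and3P; split; apply/eqP; auto.
  have [|c2 [c2ab _ _ yc2 tc2]] := inab y t.
    by rewrite !inE !negb_or; apply/and3P; split; apply/eqP; auto.
  have [|c3 [c3ab _ _ tc3 xc3]] := inab t x.
    by rewrite !inE !negb_or; apply/and3P; split; apply/eqP; auto.
  have c12 : c1 <> c2 by move=> e; rewrite e yc2 in yc1.
  have c23 : c2 <> c3 by move=> e; rewrite e tc3 in tc2.
  have c31 : c3 <> c1 by move=> e; rewrite e xc1 in xc3.
  by case: c1ab c2ab c3ab => [e1|e1] [e2|e2] [e3|e3]; congruence.
have [wa ya] : w \in a /\ y \notin a.
  have [|c [[->|->] zc wc xc yc]] := inab x y; last by rewrite (arrow_meml bw) in yc.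
    by rewrite !inE !negb_or; apply/and3P; split; apply/eqP; auto.
  by [].
have [zb xb] : z \in b /\ x \notin b.
  have [|c [[->|->] zc wc yc xc]] := inab y x.
  - by rewrite !inE !negb_or; apply/and3P; split; apply/eqP; auto.
  - by rewrite (arrow_meml ax) in xc.
  - by [].
have [aT bT] := (arrow_arc ax, arrow_arc bw).
have bzy : arrow b z y.
  case: (arrow_total bT (arrow_meml bw) zb (nesym zy)) => // byz.
  by case: nadj; apply: (competition_adj1 xy ab ax byz).
have awx : arrow a w x.
  case: (arrow_total aT (arrow_meml ax) wa (nesym wx)) => // axw.
  by case: nadj; apply: (competition_adj1 xy ab axw bw).
have bzw : arrow b z w := arrow_trans bzy bw.
have awz : arrow a w z := arrow_trans awx ax.
have ozx : out z x.
  have [//||c [cT sc wc]] := @arc_through [:: x; z] w.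
    by rewrite !inE negb_or; apply/andP; split; apply/eqP.
  have xc : x \in c by apply: sc; rewrite !inE eqxx.
  have zc : z \in c by apply: sc; rewrite !inE eqxx orbT.
  have ca : c <> a by move=> e; rewrite e wa in wc.
  have cb : c <> b by move=> e; rewrite e (arrow_memr bw) in wc.
  case: (arrow_total cT xc zc xz) => cc; last by exists c.
  by case: nadj; apply: (competition_adj2 xy wx zy cb ca ba cc bw awz).
have owy : out w y.
  have [//||c [cT sc zc]] := @arc_through [:: y; w] z.
    by rewrite !inE negb_or; apply/andP; split; apply/eqP.
  have yc : y \in c by apply: sc; rewrite !inE eqxx.
  have wc : w \in c by apply: sc; rewrite !inE eqxx orbT.
  have ca : c <> a by move=> e; rewrite e (arrow_memr ax) in zc.
  have cb : c <> b by move=> e; rewrite e zb in zc.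
  case: (arrow_total cT yc wc yw) => cc; last by exists c.
  by case: nadj'; apply: (competition_adj2 yx zy wx ca cb ab cc ax bzw).
split.
- exists w => // -[c cxw]; apply: nadj; apply: (competition_adj1 xy _ cxw bw).
  by move=> e; rewrite -e (arrow_meml cxw) in xb.
- exists z => // -[c cyz]; apply: nadj; apply: (competition_adj1 xy _ ax cyz).
  by move=> e; rewrite e (arrow_meml cyz) in ya.
move=> u ux uy v vu; have := all4 u; have := all4 v; rewrite !inE.
case/or4P=> /eqP ev; case/or4P=> /eqP eu; subst u v => //.
all: by first [assumption | exists a; assumption | exists b; assumption].
Qed.

Lemma nonadj_exceptional x y : x <> y -> ~ competition_adj T 1 2 x y ->
  ~ only_out x y -> ~ only_out y x -> exceptional x y.
Proof.
move=> xy nadj nx ny.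
have [z nz] := not_all_ex_not _ _ nx; have [[a az] zy] := imply_to_and _ _ nz.
have [w nw] := not_all_ex_not _ _ ny; have [[b bw] wx] := imply_to_and _ _ nw.
case: (classic (others_full x y)) => [|nf]; [by right | left].
have same c d u v : arrow c x u -> u <> y -> arrow d y v -> v <> x -> c = d.
  move=> cu uy dv vx; apply: NNPP => cd; apply: nf.
  exact: (two_arcs_others_full xy nadj cu uy dv vx cd).
have ab := same _ _ _ _ az zy bw wx; subst b.
exists a; split=> [||c u uy cu|c u ux cu].
- exact: arrow_meml az.
- exact: arrow_meml bw.
- exact: same cu uy bw wx.
- by apply/esym; apply: same az zy cu ux.
Qed.

Lemma one_arc_leaving_out x y u : x <> y -> one_arc_leaving x y ->
  u <> x -> u <> y ->
  exists b, [/\ arrow b u x, u \in b, x \in b & y \notin b].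
Proof.
move=> xy [a [xa ya ax ay]] ux uy.
have [//||b [bT sb yb]] := @arc_through [:: u; x] y.
  by rewrite !inE negb_or; apply/andP; split; apply/eqP; auto.
have ub : u \in b by apply: sb; rewrite !inE eqxx.
have xb : x \in b by apply: sb; rewrite !inE eqxx orbT.
exists b; split=> //; case: (arrow_total bT ub xb ux) => // bxu.
by rewrite (ax b u uy bxu) ya in yb.
Qed.

Lemma exceptional_not_full x y : x <> y -> exceptional x y ->
  ~ full x.
Proof.
move=> xy [[a [xa ya ax _]] | [[t tx nt] _ _]]; last by move/(_ t tx).
have [t ta] := arc_vertex_outside a => fx.
have [|b bt] := fx t; first by move=> e; rewrite e xa in ta.
have ty : t <> y by move=> e; rewrite e ya in ta.
by have e := ax b t ty bt; rewrite -e (arrow_memr bt) in ta.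
Qed.

Lemma exceptional_dominated x y u : x <> y ->
  exceptional x y -> u <> x -> u <> y -> out u x.
Proof.
move=> xy [one | [_ _ fu]] ux uy; last by apply: (fu u) => //; apply/nesym.
by have [b [bux _ _ _]] := one_arc_leaving_out xy one ux uy; exists b.
Qed.

Lemma exceptional_sym x y : exceptional x y ->
  exceptional y x.
Proof. by case; [left; apply: one_arc_leaving_sym | right; apply: others_full_sym]. Qed.

Lemma nonadj_not_full x y : x <> y -> ~ competition_adj T 1 2 x y ->
  [\/ only_out x y, only_out y x | ~ full x /\ ~ full y].
Proof.
move=> xy nadj; case: (classic (only_out x y)) => [|nx]; first by constructor 1.
case: (classic (only_out y x)) => [|ny]; first by constructor 2.
have c := nonadj_exceptional xy nadj nx ny; constructor 3; split.
  exact: exceptional_not_full xy c.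
by apply: exceptional_not_full (nesym xy) (exceptional_sym c).
Qed.

Definition same_pair x y u v := (x = u /\ y = v) \/ (x = v /\ y = u).

Lemma one_arc_leaving_unique x y u v : x <> y -> u <> v -> u <> x -> u <> y ->
  one_arc_leaving x y -> one_arc_leaving u v -> False.
Proof.
move=> xy uv ux uy oxy [b [ub vb bu bv]].
have [a [xa ya ax ay]] := oxy.
have leave t t' : same_pair t t' x y -> v <> t -> t \in b /\ t' \notin b.
  move=> tt vt.
  have ott' : one_arc_leaving t t'.
    by case: tt => -[-> ->] //; apply: one_arc_leaving_sym.
  have [|||c [cut uc tc t'c]] := one_arc_leaving_out _ ott' (u := u).
  1-3: by case: tt => -[? ?]; subst t t'; auto.
  by rewrite -(bu c t (nesym vt) cut).
case: (classic (v = x)) => [vx | vx].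
  have [] := leave y x; first by right.
    by rewrite vx.
  by rewrite -vx vb.
have [xb yb] : x \in b /\ y \notin b by apply: leave => //; left.
case: (classic (v = y)) => [vy | vy]; first by rewrite -vy vb in yb.
by have [] := leave y x; rewrite ?xb //; right.
Qed.

Lemma exceptional_unique x y u v : x <> y -> u <> v ->
  exceptional x y ->
  exceptional u v -> same_pair u v x y.
Proof.
have half x' y' u' v' : x' <> y' -> u' <> v' ->
    exceptional x' y' ->
    exceptional u' v' ->
    others_full x' y' \/ one_arc_leaving u' v' -> u' = x' \/ u' = y'.
  move=> xy uv cxy cuv c; apply: NNPP => /not_or_and[ux uy].
  case: c => [[_ _ fu]|ouv]; first exact: (exceptional_not_full uv cuv (fu _ ux uy)).
  case: cxy => [oxy|[_ _ fu]]; first exact: (one_arc_leaving_unique xy uv ux uy).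
  exact: (exceptional_not_full uv cuv (fu _ ux uy)).
have sub x' y' u' v' : x' <> y' -> u' <> v' ->
    exceptional x' y' ->
    exceptional u' v' ->
    others_full x' y' \/ one_arc_leaving u' v' -> same_pair u' v' x' y'.
  move=> xy uv cxy cuv c.
  have hu := half _ _ _ _ xy uv cxy cuv c.
  have := half _ _ _ _ xy (nesym uv) cxy (exceptional_sym cuv).
  case=> [|hv|hv].
  - by case: c => [|/one_arc_leaving_sym]; auto.
  - by case: hu => hu; [case: uv; rewrite hu hv | right].
  - by case: hu => hu; [left | case: uv; rewrite hu hv].
move=> xy uv cxy cuv; case: (cuv) => [o|f]; first by apply: sub => //; right.
have [] := sub u v x y uv xy cuv cxy (or_introl f).
  by case=> -> ->; left.
by case=> -> ->; right.
Qed.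

Lemma only_out_three x y z x' y' z' : x <> y -> y <> z -> z <> x ->
  only_out x x' -> only_out y y' -> only_out z z' -> False.
Proof.
move=> xy yz zx ox oy oz.
have cyc : (x' = y /\ y' = z /\ z' = x) \/ (x' = z /\ z' = y /\ y' = x).
  case: (out_total xy) => [/ox|/oy] e1; case: (out_total yz) => [/oy|/oz] e2;
    case: (out_total zx) => [/oz|/ox] e3; intuition congruence.
have [//|t] := @vertex_outside [:: x; y; z].
rewrite !inE !negb_or => /and3P[/eqP tx /eqP ty /eqP tz].
have : [\/ t = x, t = y | t = z]; last by case.
apply: (@strong_closed (fun v => [\/ v = x, v = y | v = z]) x) => [u v|].
  case=> -> => [/ox|/oy|/oz] ->; case: cyc => [[? [? ?]]|[? [? ?]]]; subst x' y' z';
    by [constructor 1 | constructor 2 | constructor 3].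
by constructor 1.
Qed.

Lemma nonadj_pairs :
  let nonadj p q := p <> q /\ ~ competition_adj T 1 2 p q in
  [\/ forall p q, ~ nonadj p q,
      exists x y, x <> y /\ forall p q, nonadj p q <-> same_pair p q x y
    | exists x z y, uniq [:: x; z; y] /\
        forall p q, nonadj p q <-> same_pair p q x z \/ same_pair p q z y].
Proof.
move=> nonadj.
have nonadjC p q : nonadj p q -> nonadj q p.
  by case=> pq npq; split; [apply/nesym | move/competition_adj_sym].
have nonadj_same p q x y : nonadj x y -> same_pair p q x y -> nonadj p q.
  by move=> nxy [] [-> ->] //; apply: nonadjC.
have only_nonadj x y : only_out x y -> nonadj x y.
  by move=> oxy; split; [apply/out_neq/only_out_out | apply: only_out_nonadj].
case: (classic (exists x y, [/\ nonadj x y, ~ only_out x y & ~ only_out y x])).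
  case=> x [y [nxy nox noy]]; have [xy nadj] := nxy.
  have cxy := nonadj_exceptional xy nadj nox noy.
  have tail u v : only_out u v -> u = x \/ u = y.
    move=> ouv; apply: NNPP => /not_or_and[ux uy]; apply: (xy).
    rewrite (ouv _ (exceptional_dominated xy cxy ux uy)).
    by rewrite (ouv _ (exceptional_dominated (nesym xy) (exceptional_sym cxy) uy ux)).
  have others p q : nonadj p q -> [\/ same_pair p q x y, only_out p q | only_out q p].
    move=> [pq npq]; case: (classic (only_out p q)) => [|np]; first by constructor 2.
    case: (classic (only_out q p)) => [|nq]; first by constructor 3.
    by constructor 1; apply: exceptional_unique (nonadj_exceptional pq npq np nq).
  case: (classic (exists u v, only_out u v)) => [[u [v ouv]]|none]; last first.
    constructor 2; exists x, y; split=> // p q; split; last exact: nonadj_same.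
    by case/others=> // o; case: none; [exists p, q | exists q, p].
  wlog ux : x y nxy nox noy xy nadj cxy tail others / u = x.
    move=> wlg; have [ux | uy] := tail _ _ ouv; first exact: (wlg x y).
    apply: (wlg y x) => //; [exact: nonadjC | exact/nesym | | exact: exceptional_sym | | ].
    - by move/competition_adj_sym.
    - by move=> u' v' /tail; tauto.
    - move=> p q /others[] H; [constructor 1 | by constructor 2 | by constructor 3].
      by case: H; [right | left].
  subst u; have vy : v <> y by move=> e; rewrite e in ouv.
  have xv := out_neq (only_out_out ouv).
  have tailx p q : only_out p q -> p = x /\ q = v.
    move=> opq; have [e | e] := tail _ _ opq; subst p.
      by split=> //; apply: ouv; apply: only_out_out.
    case: (out_total xy) => [/ouv e|/opq e]; first by case: vy.
    by case: noy; rewrite e.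
  constructor 3; exists v, x, y; split.
    rewrite /= !inE !negb_or !andbT; apply/andP; split; last exact/eqP.
    by apply/andP; split; apply/eqP; auto.
  move=> p q; split.
    case/others; [by right | |] => /tailx[-> ->]; left; by [right | left].
  by case; apply: nonadj_same => //; apply: nonadjC; apply: only_nonadj.
move=> noexc.
have only p q : nonadj p q -> only_out p q \/ only_out q p.
  move=> npq; apply: NNPP => /not_or_and[np nq].
  by apply: noexc; exists p, q.
case: (classic (exists x y, only_out x y)) => [[x [y oxy]]|none]; last first.
  by constructor 1 => p q /only[] o; apply: none; [exists p, q | exists q, p].
have xy := out_neq (only_out_out oxy).
case: (classic (exists u v, only_out u v /\ u <> x)) => [[u [v [ouv ux]]]|none].
  wlog oux : x y u v oxy xy ouv ux / out u x.
    move=> wlg; have [oux | oxu] := out_total ux; first exact: (wlg x y u v).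
    apply: (wlg u v x y) => //; last exact/nesym.
    exact: out_neq (only_out_out ouv).
  have e := ouv _ oux; subst v.
  have tail p q : only_out p q -> p = x \/ p = u.
    move=> opq; apply: NNPP => /not_or_and[px pu].
    exact: (@only_out_three x u p y x q) (nesym ux) (nesym pu) px oxy ouv opq.
  case: (classic (y = u)) => [yu | yu].
    constructor 2; exists x, y; split=> // p q; split.
      case/only=> o; case: (tail _ _ o) => e; subst.
      + by left; split=> //; apply: oxy; apply: only_out_out.
      + by right; split=> //; apply: ouv; apply: only_out_out.
      + by right; split=> //; apply: oxy; apply: only_out_out.
      + by left; split=> //; apply: ouv; apply: only_out_out.
    by apply: nonadj_same; apply: only_nonadj.
  constructor 3; exists u, x, y; split.
    rewrite /= !inE !negb_or !andbT; apply/andP; split; last exact/eqP.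
    by apply/andP; split; apply/eqP; auto.
  move=> p q; split; last by case; apply: nonadj_same; apply: only_nonadj.
  case/only=> o; case: (tail _ _ o) => e; subst.
  + by right; left; split=> //; apply: oxy; apply: only_out_out.
  + by left; left; split=> //; apply: ouv; apply: only_out_out.
  + by right; right; split=> //; apply: oxy; apply: only_out_out.
  + by left; right; split=> //; apply: ouv; apply: only_out_out.
constructor 2; exists x, y; split=> // p q; split; last first.
  by apply: nonadj_same; apply: only_nonadj.
have tail s t : only_out s t -> s = x /\ t = y.
  move=> ost; have e : s = x by apply: NNPP => sx; case: none; exists s, t.
  by subst s; split=> //; apply: oxy; apply: only_out_out.
by case/only=> /tail[-> ->]; [left | right].
Qed.

End Nonedges.

Section KeyedHypertournament.
Variables (V : finType) (k : nat) (key : {set V} -> V -> nat).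
Hypothesis key_inj : forall S, injective (key S).

Definition key_lt (S : {set V}) : rel V := relpre (key S) ltn.

Definition keyed_arcs : {set k.-tuple V} :=
  [set a : k.-tuple V | sorted (key_lt [set v in a]) a].

Lemma key_lt_trans S : transitive (key_lt S).
Proof. by move=> y x z; apply: ltn_trans. Qed.

Lemma key_lt_irr S : irreflexive (key_lt S).
Proof. by move=> x; apply: ltnn. Qed.

Lemma keyed_arcs_uniq a : a \in keyed_arcs -> uniq a.
Proof. rewrite inE; apply: sorted_uniq; [exact: key_lt_trans | exact: key_lt_irr]. Qed.

Lemma keyed_arcs_choice (S : {set V}) : #|S| = k ->
  exists! a : k.-tuple V, a \in keyed_arcs /\ [set v in a] = S.
Proof.
move=> cS; pose s := sort (relpre (key S) leq) (enum S).
have ss : size s == k by rewrite size_sort -cardE cS.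
have es : [set v in Tuple ss] = S by apply/setP=> v; rewrite inE mem_sort mem_enum.
have lts : sorted (key_lt S) s.
  rewrite /key_lt -sorted_map ltn_sorted_uniq_leq.
  rewrite map_inj_uniq ?sort_uniq ?enum_uniq // sorted_map /=.
  by apply: sort_sorted => x y; apply: leq_total.
exists (Tuple ss); split=> [|b [+ bS]]; first by rewrite inE es.
rewrite inE bS => ltb; apply/val_inj.
apply: (irr_sorted_eq (@key_lt_trans S) (@key_lt_irr S)) => // v.
by move/setP/(_ v): es; rewrite -bS !inE.
Qed.

Definition keyed : hypertournament V k :=
  Hypertournament keyed_arcs_uniq keyed_arcs_choice.

Lemma arrow_keyed a x y : a \in arcs keyed -> x \in a -> y \in a ->
  arrow keyed a x y = (key [set v in a] x < key [set v in a] y).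
Proof.
have lt u v : a \in arcs keyed -> u \in a -> v \in a ->
    index u a < index v a -> key [set v in a] u < key [set v in a] v.
  rewrite inE => sa ua va.
  exact: (sorted_ltn_index (@key_lt_trans [set v in a]) sa).
move=> aT xa ya; rewrite /arrow /dominates aT xa ya /=; apply/idP/idP.
  exact: lt.
case: (ltngtP (index x a) (index y a)) => //.
  by move/(lt y x aT ya xa) => h1 h2; have := ltn_trans h1 h2; rewrite ltnn.
by move/(index_inj x xa ya) => ->; rewrite ltnn.
Qed.

End KeyedHypertournament.

Lemma arrow_keyed_lt (V : finType) (k : nat) (key : {set V} -> V -> nat)
    (key_inj : forall S, injective (key S)) (a : k.-tuple V) x y :
  arrow (keyed k key_inj) a x y -> key [set v in a] x < key [set v in a] y.
Proof.
move=> axy; rewrite -(arrow_keyed (arrow_arc axy)) //.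
  exact: arrow_meml axy.
exact: arrow_memr axy.
Qed.

Lemma arrow_through (V : finType) (k : nat) (key : {set V} -> V -> nat)
    (key_inj : forall S, injective (key S)) (s : seq V) t x y :
  2 < k -> k < #|V| -> size s <= 3 -> t \notin s -> x \in s -> y \in s ->
  (forall S : {set V}, {subset s <= S} -> t \notin S -> key S x < key S y) ->
  exists a, [/\ arrow (keyed k key_inj) a x y, {subset s <= a} & t \notin a].
Proof.
move=> k3 kV s3 ts xs ys lt_xy.
have [a [aT sa ta]] := arc_through (keyed k key_inj) k3 kV s3 ts.
exists a; split=> //; rewrite arrow_keyed ?sa //; apply: lt_xy.
  by move=> v vs; rewrite inE sa.
by rewrite inE.
Qed.

Lemma strong_of_two_steps (V : finType) (k : nat) (T : hypertournament V k) :
  (forall x y, x <> y -> out T x y \/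
     exists a b u, [/\ arrow T a x u, arrow T b u y & a <> b]) ->
  strong T.
Proof.
move=> two x y xy; have [[a axy] | [a [b [u [axu buy ab]]]]] := two _ _ xy.
  case/andP: axy => aT axy; exists [:: (a, y)].
  by split; rewrite /= ?aT ?axy ?inE ?andbT //; apply/eqP.
have [xu uy] := (arrow_neq axu, arrow_neq buy).
case/andP: axu => aT axu; case/andP: buy => bT buy; exists [:: (a, u); (b, y)].
split; rewrite /= ?aT ?bT ?axu ?buy ?inE ?negb_or ?andbT //; last exact/eqP.
by repeat (apply/andP; split); apply/eqP.
Qed.

Section Constructions.
Variables m k : nat.
Local Notation n := m.+4.
Hypotheses (k3 : 2 < k) (kn : k < n).
Implicit Types (u v : 'I_n) (S : {set 'I_n}).

Let v0 : 'I_n := @Ordinal n 0 isT.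
Let v1 : 'I_n := @Ordinal n 1 isT.
Let v2 : 'I_n := @Ordinal n 2 isT.
Let v3 : 'I_n := @Ordinal n 3 isT.

Let kV : k < #|'I_n|. Proof. by rewrite card_ord. Qed.

(* Any two vertices other than [v1] dominate each other, in an arc through [v1]
   and in an arc avoiding [v1]. *)
Definition alt_key S v : nat := if v1 \in S then n - v else v.+1.

Definition complete_key S v : nat :=
  if v == v1 then (if v0 \in S then 0 else n.+2) else alt_key S v.

Definition initial_set : {set 'I_n} := [set v : 'I_n | v < k].

(* The arrows leaving [{v1, v2}] all lie in the arc on [initial_set], and its
   only arrow from [v1] ends in [v0]. *)
Definition path3_key S v : nat :=
  if S == initial_set then n - v
  else if v == v1 then n.+3 else if v == v2 then n.+2 else alt_key S v.

Lemma alt_key_inj S : injective (alt_key S).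
Proof.
move=> u v; have := (ltn_ord u, ltn_ord v); rewrite /alt_key => -[ltu ltv] e.
by apply: val_inj; case: ifP e => _ /=; lia.
Qed.

Lemma alt_key_bounds S v : 0 < alt_key S v <= n.
Proof. by have := ltn_ord v; rewrite /alt_key; case: ifP => _; lia. Qed.

Lemma complete_key_inj S : injective (complete_key S).
Proof.
move=> u v; have := alt_key_bounds S u; have := alt_key_bounds S v.
rewrite /complete_key; case: eqP => [->|_]; case: eqP => [->|_] //; last first.
- by move=> _ _ /alt_key_inj.
all: by case: ifP => _; lia.
Qed.

Lemma path3_key_inj S : injective (path3_key S).
Proof.
move=> u v; have := alt_key_bounds S u; have := alt_key_bounds S v.
rewrite /path3_key; case: ifP => _.
  by have := (ltn_ord u, ltn_ord v) => -[ltu ltv] _ _ e; apply: val_inj => /=; lia.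
case: eqP => [->|_]; case: eqP => [->|_] //; try lia;
  case: eqP => [->|_] //; try lia; case: eqP => [->|_] //; try lia.
by move=> _ _ /alt_key_inj.
Qed.

Lemma ord_neq u v : u <> v -> (u : nat) != v.
Proof. by move=> uv; apply/eqP=> /val_inj. Qed.

Section Keyed.
Variable key : {set 'I_n} -> 'I_n -> nat.
Hypothesis key_inj : forall S, injective (key S).
Local Notation T := (keyed k key_inj).

Lemma arrow_avoiding t u v : u <> t -> v <> t ->
  (forall S, u \in S -> v \in S -> t \notin S -> key S u < key S v) ->
  exists2 a, arrow T a u v & t \notin a.
Proof.
move=> ut vt ltuv.
have [||||S sS tS|a [auv _ ta]] := @arrow_through _ k _ key_inj [:: u; v] t u v k3 kV.
- by [].
- by rewrite !inE negb_or; apply/andP; split; apply/eqP; auto.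
- by rewrite !inE eqxx.
- by rewrite !inE eqxx orbT.
- by apply: ltuv => //; apply: sS; rewrite !inE eqxx ?orbT.
by exists a.
Qed.

Lemma out_through w u v :
  (forall S, w \in S -> u \in S -> v \in S -> key S u < key S v) -> out T u v.
Proof.
move=> ltuv; have [//|t tn] := @vertex_outside _ k k3 kV [:: w; u; v].
have [||||S sS tS|a [auv _ ta]] := @arrow_through _ k _ key_inj [:: w; u; v] t u v k3 kV.
- by [].
- by [].
- by rewrite !inE eqxx orbT.
- by rewrite !inE eqxx !orbT.
- by apply: ltuv; apply: sS; rewrite !inE eqxx ?orbT.
by exists a.
Qed.

Lemma out_alternating t u v : u <> v -> t <> v1 -> u <> v1 -> v <> v1 ->
  u <> t -> v <> t ->
  (forall S, t \notin S \/ v1 \notin S ->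
     key S u = alt_key S u /\ key S v = alt_key S v) ->
  out T u v.
Proof.
move=> uv t1 u1 v1' ut vt key_alt; have [lt|lt] : u < v \/ v < u.
- by have := ord_neq uv; lia.
- have [|||a auv _] := @arrow_avoiding v1 u v; [by [] | by [] | | by exists a].
  move=> S _ _ v1S; have [|-> ->] := key_alt S; first by right.
  by rewrite /alt_key (negPf v1S).
have [||||S sS tS|a [auv _ _]] := @arrow_through _ k _ key_inj [:: v1; u; v] t u v k3 kV.
- by [].
- by rewrite !inE !negb_or; apply/and3P; split; apply/eqP; auto.
- by rewrite !inE eqxx orbT.
- by rewrite !inE eqxx !orbT.
- have [|-> ->] := key_alt S; first by left.
  by rewrite /alt_key sS ?inE ?eqxx //; have := ltn_ord u; lia.
by exists a.
Qed.

End Keyed.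

Lemma ord_cases v : [\/ v = v0, v = v1, v = v2 | 2 < v].
Proof.
case: v => -[|[|[|v]]] lt_v; [constructor 1|constructor 2|constructor 3|by constructor 4];
  exact: val_inj.
Qed.

Lemma third_vertex u v : exists t, [/\ t <> v1, u <> t & v <> t].
Proof.
have [//|t] := @vertex_outside _ k k3 kV [:: v1; u; v].
by rewrite !inE !negb_or => /and3P[/eqP ? /eqP ? /eqP ?]; exists t; split; auto.
Qed.

Lemma complete_competition : exists T : hypertournament 'I_n k, strong T /\
  forall u v, complete_adj u v <-> competition_adj T 1 2 u v.
Proof.
pose T := keyed k complete_key_inj; exists T.
have out_alt u v : u <> v -> u <> v1 -> v <> v1 -> out T u v.
  move=> uv u1 v1'; have [t [t1 ut vt]] := third_vertex u v.
  apply: (@out_alternating _ _ t) => // S _; rewrite /complete_key.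
  by do 2 (case: eqP => // _).
have out1 v : v <> v1 -> out T v1 v.
  move=> /eqP vv1; apply: (@out_through _ _ v0) => S S0 _ _.
  by rewrite /complete_key eqxx S0 (negPf vv1); case/andP: (alt_key_bounds S v).
have to1 v : v <> v0 -> v <> v1 -> exists2 a, arrow T a v v1 & v0 \notin a.
  move=> vv0 /[dup] vv1 /eqP vv1'; apply: arrow_avoiding => // S _ _ S0.
  rewrite /complete_key eqxx (negPf S0) (negPf vv1').
  by case/andP: (alt_key_bounds S v); lia.
have fullT u : u <> v0 -> full T u.
  move=> u0 v vu; case: (classic (u = v1)) => [e|u1]; first by subst u; apply: out1.
  case: (classic (v = v1)) => [->|vv1]; last by apply: out_alt; auto.
  by have [a ? _] := to1 u u0 u1; exists a.
have stT : strong T.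
  apply: strong_of_two_steps => u v uv.
  case: (classic (u = v0)) => [u0|u0]; last by left; apply: fullT; auto.
  subst u; case: (classic (v = v1)) => [vv1|vv1]; last by left; apply: out_alt.
  subst v; right; have [a av _] : exists2 a, arrow T a v0 v2 & v1 \notin a.
    apply: arrow_avoiding => // S _ _ v1S.
    by rewrite /complete_key /alt_key (negPf v1S).
  have [//|//|b bv b0] := to1 v2.
  by exists a, b, v2; split=> // e; rewrite -e (arrow_meml av) in b0.
have not_only u v : ~ only_out T u v.
  case: (classic (u = v0)) => [->|u0]; last first.
    by apply: (full_not_only_out k3 kV); apply: fullT.
  have [o2 o3] : out T v0 v2 /\ out T v0 v3 by split; apply: out_alt.
  by move=> o; have := o _ o2; rewrite -(o _ o3).
split=> // u v; split=> [uv|/[swap] -> /competition_adj_irrefl//].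
apply: NNPP => /(nonadj_not_full k3 kV uv)[/not_only//|/not_only//|[nu nv]].
apply: uv; have -> : u = v0 by apply: NNPP => /fullT.
by symmetry; apply: NNPP => /fullT.
Qed.

Lemma minus_edge_competition : exists T : hypertournament 'I_n k, strong T /\
  forall u v, complete_minus_path_adj 2 u v <-> competition_adj T 1 2 u v.
Proof.
pose T := keyed k alt_key_inj; exists T.
have out_alt u v : u <> v -> u <> v1 -> v <> v1 -> out T u v.
  move=> uv u1 v1'; have [t [t1 ut vt]] := third_vertex u v.
  exact: (@out_alternating _ _ t).
have decr u v : v < u -> u = v1 \/ v = v1 -> out T u v.
  move=> lt uv1; apply: (@out_through _ _ v1) => S S1 _ _.
  by rewrite /alt_key S1; have := ltn_ord u; lia.
have only1 : only_out T v1 v0.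
  move=> v [a av]; have := arrow_keyed_lt av.
  rewrite /alt_key inE (arrow_meml av) /= => lt.
  by apply: val_inj => /=; lia.
have fullT u : 1 < u -> full T u.
  move=> u1 v vu; case: (classic (v = v1)) => [->|vv1]; first by apply: decr; auto.
  by apply: out_alt; auto; move=> e; rewrite e in u1.
have avoid u v : u < v -> u <> v1 -> v <> v1 -> exists2 a, arrow T a u v & v1 \notin a.
  move=> lt u1 vv1; apply: arrow_avoiding => // S _ _ v1S.
  by rewrite /alt_key (negPf v1S).
have stT : strong T.
  apply: strong_of_two_steps => u v uv.
  have [u1|u1] := ltnP 1 u; first by left; apply: fullT => //; apply/nesym.
  have [u0|{}u1] : u = v0 \/ u = v1.
  - by have [|||] := ord_cases u => u2; auto; move: u1; rewrite ?u2 //; lia.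
  - subst u; case: (classic (v = v1)) => [vv1|vv1]; last by left; apply: out_alt.
    subst v; right; have [//|//|//|a av a1] := avoid v0 v2.
    have [b bv] : out T v2 v1 by apply: decr; auto.
    by exists a, b, v2; split=> // e; rewrite e (arrow_memr bv) in a1.
  subst u; case: (classic (v = v0)) => [->|vv0]; first by left; apply: decr; auto.
  right; have [a av] : out T v1 v0 by apply: decr; auto.
  have [|||b bv b1] := avoid v0 v; first by have := ord_neq vv0; rewrite /=; lia.
  - by [].
  - by apply/nesym.
  by exists a, b, v0; split=> // e; rewrite -e (arrow_meml av) in b1.
have tail u v : only_out T u v -> u = v1 /\ v = v0.
  have [->|->|->|u2] := ord_cases u.
  - have [o2 o3] : out T v0 v2 /\ out T v0 v3 by split; apply: out_alt.
    by move=> o; have := o _ o2; rewrite -(o _ o3).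
  - by move=> o; split=> //; rewrite (o v0) //; apply: decr; auto.
  - by move/(full_not_only_out k3 kV) => []; apply: fullT.
  - by move/(full_not_only_out k3 kV) => []; apply: fullT; lia.
have nonfull u : ~ full T u -> u = v0 \/ u = v1.
  by move=> nu; have [|||] := ord_cases u => u2; auto; case: nu; apply: fullT; rewrite ?u2 //; lia.
have nadj01 : ~ competition_adj T 1 2 v1 v0 by exact: only_out_nonadj.
split=> // u v; split=> [[uv ne]|adjuv]; last first.
  split=> [uv|[]]; first by move: adjuv; rewrite uv => /competition_adj_irrefl.
  move=> u2 vv2 [] e.
    apply: nadj01; apply: competition_adj_sym.
    have -> : v0 = u by apply: val_inj => /=; lia.
    by have -> : v1 = v by apply: val_inj => /=; lia.
  apply: nadj01; have -> : v1 = u by apply: val_inj => /=; lia.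
  by have -> : v0 = v by apply: val_inj => /=; lia.
apply: NNPP => /(nonadj_not_full k3 kV uv) c; apply: ne.
case: c => [/tail[-> ->]|/tail[-> ->]|[/nonfull nu /nonfull nv]].
- by split; auto.
- by split; auto.
by case: nu nv uv => -> [] -> //; split; auto.
Qed.

Lemma minus_path3_competition : exists T : hypertournament 'I_n k, strong T /\
  forall u v, complete_minus_path_adj 3 u v <-> competition_adj T 1 2 u v.
Proof.
pose T := keyed k path3_key_inj; exists T.
have mem_initial v : v < 3 -> v \in initial_set by rewrite inE; lia.
have non_initial S v : v < 3 -> v \notin S -> (S == initial_set) = false.
  by move=> v3' vS; apply: contraNF vS => /eqP->; apply: mem_initial.
have [a0 [[a0T a0S] a0U]] : exists! a : k.-tuple 'I_n,
    a \in arcs T /\ [set v in a] = initial_set.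
  apply: arcs_choice; rewrite /initial_set -sum1dep_card.
  by rewrite (big_ord_narrow (ltnW kn)) sum1_card card_ord.
have a0P v : v < 3 -> v \in a0.
  by move=> v3'; have := mem_initial v v3'; rewrite -a0S inE.
have a0_arrow u v : u < 3 -> v < u -> arrow T a0 u v.
  move=> u3 vu; rewrite arrow_keyed ?a0P //; last lia.
  by rewrite a0S /path3_key eqxx; have := ltn_ord u; lia.
have out_alt u v : u <> v -> u <> v1 -> v <> v1 -> u <> v2 -> v <> v2 -> out T u v.
  move=> uv u1 v1' u2 v2'; apply: (@out_alternating _ _ v2) => // S nS.
  have nSi : (S == initial_set) = false by case: nS; apply: non_initial.
  by rewrite /path3_key nSi; do 4 (case: eqP => // _).
have key_le S v : path3_key S v <= n.+3.
  case/andP: (alt_key_bounds S v) => _ ?.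
  by rewrite /path3_key; repeat case: ifP => _; lia.
have key2 S v : S <> initial_set -> n.+2 < path3_key S v -> v = v1.
  move=> /eqP/negPf Si; case/andP: (alt_key_bounds S v) => _ ?.
  rewrite /path3_key Si; case: (v =P v1) => // _; case: ifP => _; lia.
have to1 v : v <> v1 -> v <> v2 -> out T v v1.
  move=> vv1 vv2; have [//|//||a av _] := @arrow_avoiding _ path3_key_inj v2 v v1.
    move=> S _ _ S2; rewrite /path3_key (non_initial S v2) //=.
    case/andP: (alt_key_bounds S v) => _ ?.
    by case: eqP => // _; case: eqP => // _; lia.
  by exists a.
have to2 v : v <> v1 -> v <> v2 -> exists2 a, arrow T a v v2 & v1 \notin a.
  move=> vv1 vv2; apply: arrow_avoiding => // S _ _ S1.
  rewrite /path3_key (non_initial S v1) //=.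
  case/andP: (alt_key_bounds S v) => _ ?.
  by case: eqP => // _; case: eqP => // _; lia.
have from0 v : v <> v0 -> v <> v1 -> exists2 a, arrow T a v0 v & v1 \notin a.
  move=> vv0 vv1; case: (classic (v = v2)) => [->|vv2]; first exact: to2.
  apply: arrow_avoiding => // S _ _ S1.
  rewrite /path3_key (non_initial S v1) //= /alt_key (negPf S1).
  by do 2 (case: eqP => // _); have := ord_neq vv0; rewrite /=; lia.
have fullT u : u <> v1 -> u <> v2 -> full T u.
  move=> u1 u2 v vu; case: (classic (v = v1)) => [->|vv1]; first exact: to1.
  case: (classic (v = v2)) => [->|vv2]; last by apply: out_alt; auto.
  by have [a ? _] := to2 u u1 u2; exists a.
have only1 : only_out T v1 v0.
  move=> v [a av]; have := arrow_keyed_lt av.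
  case: (classic ([set v in a] = initial_set)) => [->|/eqP/negPf Si].
    by rewrite /path3_key eqxx /= => lt; apply: val_inj => /=; lia.
  by have := key_le [set v in a] v; rewrite {2}/path3_key Si eqxx; lia.
have leave2 a v : v <> v1 -> arrow T a v2 v -> a = a0.
  move=> vv1 av; have lt := arrow_keyed_lt av.
  case: (classic ([set v in a] = initial_set)) => [Si|Si].
    by apply/esym/a0U; split=> //; apply: arrow_arc av.
  by case: vv1; apply: (key2 _ _ Si); move: lt; rewrite {1}/path3_key; move/eqP/negPf: Si => ->.
have leave1 a v : arrow T a v1 v -> a = a0.
  move=> av; have lt := arrow_keyed_lt av.
  case: (classic ([set v in a] = initial_set)) => [Si|/eqP/negPf Si].
    by apply/esym/a0U; split=> //; apply: arrow_arc av.
  by have := key_le [set v in a] v; move: lt; rewrite {1}/path3_key Si eqxx; lia.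
have out21 : out T v2 v1 by exists a0; apply: a0_arrow.
have out20 : out T v2 v0 by exists a0; apply: a0_arrow.
have stT : strong T.
  have via0 u v : arrow T a0 u v0 -> v <> v0 -> v <> v1 ->
      exists a b w, [/\ arrow T a u w, arrow T b w v & a <> b].
    move=> au vv0 vv1; have [b bv b1] := from0 v vv0 vv1; exists a0, b, v0; split=> //.
    by move=> e; rewrite -e a0P in b1.
  apply: strong_of_two_steps => u v uv.
  case: (classic (u = v1)) => [u1|u1].
    subst u; case: (classic (v = v0)) => [->|vv0]; last first.
      by right; apply: via0; [exact: a0_arrow | | apply/nesym].
    by left; exists a0; apply: a0_arrow.
  case: (classic (u = v2)) => [u2|u2]; last by left; apply: fullT; auto.
  subst u; case: (classic (v = v0)) => [->|vv0]; first by left.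
  case: (classic (v = v1)) => [->|vv1]; first by left.
  by right; apply: via0 => //; apply: a0_arrow.
have tail u v : only_out T u v -> u = v1 /\ v = v0.
  case: (classic (u = v1)) => [->|u1].
    by move=> o; split=> //; rewrite (o v0) //; exists a0; apply: a0_arrow.
  case: (classic (u = v2)) => [->|u2].
    by move=> o; have := o _ out21; rewrite -(o _ out20).
  by move/(full_not_only_out k3 kV) => []; apply: fullT.
have nonfull u : ~ full T u -> u = v1 \/ u = v2.
  by move=> nu; apply: NNPP => /not_or_and[u1 u2]; apply/nu/fullT.
have nadj10 : ~ competition_adj T 1 2 v1 v0 by exact: only_out_nonadj.
have nadj12 : ~ competition_adj T 1 2 v1 v2.
  move=> /competition_adj_leaving[a [b [z [w [az bw zv wv]]]]].
  by rewrite (leave1 _ _ az) (leave2 _ _ wv bw).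
split=> // u v; split=> [[uv ne]|adjuv]; last first.
  split=> [uv|[]]; first by move: adjuv; rewrite uv => /competition_adj_irrefl.
  have adjvu := competition_adj_sym adjuv.
  have [] := ord_cases u; have [] := ord_cases v => ev eu; rewrite ?ev ?eu /=;
    try lia; subst u v => //; move=> _ _ []; lia.
apply: NNPP => /(nonadj_not_full k3 kV uv) c; apply: ne.
case: c => [/tail[-> ->]|/tail[-> ->]|[/nonfull nu /nonfull nv]].
- by split; auto.
- by split; auto.
by case: nu nv uv => -> [] -> //; split; auto.
Qed.

End Constructions.

Lemma nonadj_adj (V : finType) (k : nat) (T : hypertournament V k) p q :
  competition_adj T 1 2 p q <->
  p <> q /\ ~ (p <> q /\ ~ competition_adj T 1 2 p q).
Proof.
split=> [adj_pq | [pq /not_and_or[//|/NNPP//]]].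
by split=> [e|[]//]; move: adj_pq; rewrite e => /competition_adj_irrefl.
Qed.

Lemma sgraph_iso_trans (V W X : finType) (G : sgraph V) (H : sgraph W)
    (K : sgraph X) : sgraph_iso G H -> sgraph_iso H K -> sgraph_iso G K.
Proof.
move=> [f [bf fP]] [g [bg gP]]; exists (g \o f); split; first exact: bij_comp.
by move=> x y; apply: iff_trans (fP x y) (gP _ _).
Qed.

Lemma step_competition_graph_iso (V : finType) (k : nat)
    (T : hypertournament V k) : 2 < k -> k < #|V| -> strong T ->
  let H := step_competition_graph T 1 2 in
  [\/ sgraph_iso H (complete_graph #|V|),
      sgraph_iso H (complete_minus_path #|V| 2)
    | sgraph_iso H (complete_minus_path #|V| 3)].
Proof.
move=> k3 kV stT H.
have [none | [x [y [xy pairs]]] | [x [z [y [xzy pairs]]]]] := nonadj_pairs k3 kV stT.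
- have [g [bg _]] := @prefix_bijection V [::] isT; constructor 1; exists g; split=> // p q.
  apply: iff_trans (nonadj_adj T p q) _; rewrite /= /complete_adj.
  split=> [[pq _] /(bij_inj bg)//|npq]; split; last exact: none.
  by move=> e; apply: npq; rewrite e.
- have [|g [bg gE]] := @prefix_bijection V [:: x; y].
    by rewrite /= inE andbT; apply/eqP.
  have gx : g x = 0 :> nat by rewrite gE ?inE ?eqxx //= eqxx.
  have gy : g y = 1 :> nat.
    by rewrite gE ?inE ?eqxx ?orbT //= eqxx; case: eqP.
  have gK u v : g u = g v :> nat -> u = v by move/val_inj/(bij_inj bg).
  constructor 2; exists g; split=> // p q.
  apply: iff_trans (nonadj_adj T p q) _.
  rewrite /= /complete_minus_path_adj pairs.
  suff -> : same_pair p q x y <-> path_edge 2 (g p) (g q).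
    by split=> -[pq ?]; split=> // e; apply: pq; [apply: (bij_inj bg) | rewrite e].
  split=> [[] [-> ->]|[p2 q2 pq]]; [by split; lia | by split; lia |].
  by case: pq => e; [left | right]; split; apply: gK; lia.
- have [//|g [bg gE]] := @prefix_bijection V [:: x; z; y].
  move: xzy; rewrite /= !inE negb_or andbT => /andP[/andP[/eqP xz /eqP xy] /eqP zy].
  have gx : g x = 0 :> nat by rewrite gE ?inE ?eqxx //= eqxx.
  have gz : g z = 1 :> nat.
    by rewrite gE ?inE ?eqxx ?orbT //= eqxx; case: eqP.
  have gy : g y = 2 :> nat.
    by rewrite gE ?inE ?eqxx ?orbT //= eqxx; do 2 case: eqP => //.
  have gK u v : g u = g v :> nat -> u = v by move/val_inj/(bij_inj bg).
  constructor 3; exists g; split=> // p q.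
  apply: iff_trans (nonadj_adj T p q) _.
  rewrite /= /complete_minus_path_adj pairs.
  suff -> : same_pair p q x z \/ same_pair p q z y <-> path_edge 3 (g p) (g q).
    by split=> -[pq ?]; split=> // e; apply: pq; [apply: (bij_inj bg) | rewrite e].
  split=> [[] [] [-> ->]|[p3 q3 pq]]; try by split; lia.
  have [p0|p0] := eqVneq (g p : nat) 0; first by left; left; split; apply: gK; lia.
  have [p2|p2] := eqVneq (g p : nat) 2; first by right; right; split; apply: gK; lia.
  by case: pq => e; [right; left | left; right]; split; apply: gK; lia.
Qed.

Theorem theorem4p1 (n k : nat) (hk3 : 3 <= k) (hkn : k <= n - 1)
    (V : finType) (hV : #|V| = n) (G : sgraph V) :
  (exists (W : finType) (T : hypertournament W k),
     [/\ #|W| = n, strong T & sgraph_iso G (step_competition_graph T 1 2)])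
  <->
  [\/ sgraph_iso G (complete_graph n),
      sgraph_iso G (complete_minus_path n 2)
    | sgraph_iso G (complete_minus_path n 3)].
Proof.
split=> [[W [T [cW stT isoG]]]|].
  have kW : k < #|W| by rewrite cW; lia.
  by case: (step_competition_graph_iso hk3 kW stT); rewrite cW => isoT;
    [constructor 1 | constructor 2 | constructor 3]; apply: sgraph_iso_trans isoT.
have realize (H : sgraph 'I_n) :
    (exists T : hypertournament 'I_n k, strong T /\
       forall u v, adj H u v <-> competition_adj T 1 2 u v) ->
    sgraph_iso G H ->
    exists (W : finType) (T : hypertournament W k),
      [/\ #|W| = n, strong T & sgraph_iso G (step_competition_graph T 1 2)].
  move=> [T [stT TP]] isoG; exists 'I_n, T; split; rewrite ?card_ord //.
  by apply: sgraph_iso_trans isoG _; exists id; split=> //; exists id.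
have [m en] : exists m, n = m.+4 by exists (n - 4); lia.
have kn : k < n by lia.
clear hV; subst n; case; apply: realize.
- exact: complete_competition.
- exact: minus_edge_competition.
- exact: minus_path3_competition.
Qed.
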